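(* Let $F$ be a finite forest with no isolated vertices and with at most one vertex of degree $2$, and let $n_1$ be the number of vertices of degree $1$ in $F$. Then \[ tvs(F)=\left\lceil \tfrac{n_1+1}{2} \right\rceil. \]
   Context: Graphs are finite, simple and undirected. For a graph $G$, a total weighting is a map $w: V(G)\cup E(G)\to \{1,2,\dots\}$; the weighted degree of a vertex $v$ is $wt_G(v)=w(v)+\sum_{e\in E(G),\, v\in e} w(e)$. The weighting is irregular if $wt_G(u)\neq wt_G(v)$ for all distinct $u,v\in V(G)$. The total vertex irregularity strength $tvs(G)$ is the smallest integer $s$ such that there is an irregular total weighting of $G$ with values in $\{1,2,\dots,s\}$. *)

(* Defs.v *)
(* A finite simple graph is a symmetric irreflexive relation
   e : rel V on a finite type V; edges are the 2-sets [set u; v] with e u v. *)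
From mathcomp Require Import all_boot all_order.
Set Implicit Arguments. Unset Strict Implicit. Unset Printing Implicit Defensive.

Definition simple_graph (V : finType) (e : rel V) : Prop :=
  symmetric e /\ irreflexive e.

Definition deg (V : finType) (e : rel V) (v : V) : nat := #|[set u | e v u]|.

Definition forest (V : finType) (e : rel V) : Prop :=
  forall s : seq V, uniq s -> 3 <= size s -> ~~ cycle e s.

(* total weighting: wv on vertices, we on edges (indexed by the 2-set {u,v}) *)
Definition wdeg (V : finType) (e : rel V) (wv : V -> nat) (we : {set V} -> nat)
    (v : V) : nat :=
  wv v + \sum_(u in V | e v u) we [set v; u].

Definition has_irregular_weighting (V : finType) (e : rel V) (s : nat) : Prop :=
  exists (wv : V -> nat) (we : {set V} -> nat),
    (forall v, 1 <= wv v <= s) /\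
    (forall u v, e u v -> 1 <= we [set u; v] <= s) /\
    injective (wdeg e wv we).

Definition is_tvs (V : finType) (e : rel V) (s : nat) : Prop :=
  0 < s /\ has_irregular_weighting e s /\
  (forall t, 0 < t -> has_irregular_weighting e t -> s <= t).

Definition n_deg (V : finType) (e : rel V) (k : nat) : nat :=
  #|[set v | deg e v == k]|.

(* Main.v *)
Require Import Defs.
From mathcomp Require Import all_boot all_order.
From mathcomp Require Import zify.
Set Implicit Arguments. Unset Strict Implicit. Unset Printing Implicit Defensive.

(* Let s = n1 / 2 + 1. The leaf weights are distinct values in [2, 2s], whence the lower bound.
   For the upper bound, split the leaves into at most s "upper" leaves U and at most s - 1
   "low" leaves D, such that a neighbour of the vertex of degree 2 is never low and every
   vertex with at least two leaf neighbours has an upper one. Edges without low end get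
   weight s, edges at a low leaf get weight 1, except that when the other end v is not low and
   has at most one non-low edge, the edge to the last low leaf of v gets the number of that
   leaf (the two ends of an isolated edge between U and D carry the same number).
   Then the low leaves can take the values in [2, s], the upper ones those in [s+1, 2s], and
   an internal vertex with at most two non-low edges the value 2s + (weight of its last low
   leaf), or 2s + 1 if there is none, which happens only for the vertex of degree 2. An
   internal vertex with at least three non-low edges sees edges of total weight at least 3s,
   so it may choose among s consecutive values above 3s; by acyclicity there are at most
   #|U| <= s such vertices, and distinct residues modulo s keep their values apart. *)

(** * Degrees in subsets of a forest *)

(** Otherwise a path inside [S] could always be extended at its head, since a head with all its
    neighbours on the path would close a cycle; paths would then outgrow [V]. *)
Lemma forest_low_degree (V : finType) (e : rel V) (S : {set V}) :
  simple_graph e -> forest e -> S != set0 ->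
  exists2 v, v \in S & #|[set u in S | e v u]| <= 1.
Proof.
move=> [e_sym e_irr] e_acyclic /set0Pn[x0 x0S].
case: (boolP [exists v in S, #|[set u in S | e v u]| <= 1]) => [/exists_inP[v ? ?]|].
  by exists v.
rewrite negb_exists_in => /forall_inP deg2.
have long n : exists x p, [/\ path e x p, uniq (x :: p), all [in S] (x :: p) & size p = n].
  elim: n => [|n [x [p [ep up pS sp]]]]; first by exists x0, [::]; rewrite /= x0S.
  have xS : x \in S by case/andP: pS.
  case: (boolP [exists y in S, e x y && (y \notin x :: p)]) => [|].
    case/exists_inP=> y yS /andP[exy yp]; exists y, (x :: p).
    by split; rewrite ?[LHS]/= ?sp // /= ?yS ?xS -?[e y x]e_sym ?exy ?yp //;
       case/andP: pS.
  rewrite negb_exists_in => /forall_inP closed.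
  have := deg2 x xS; rewrite -ltnNge => deg2x; exfalso.
  have in_p y : y \in [set u in S | e x u] -> y \in p.
    rewrite inE => /andP[yS exy]; have := closed y yS; rewrite exy /= negbK inE.
    by case: eqP => // yx; rewrite yx e_irr in exy.
  case: p => [|y1 p] in ep up pS sp closed in_p *.
    have /set0Pn[y /in_p //] : [set u in S | e x u] != set0 by rewrite -card_gt0; lia.
  (* [y1] follows the head [x]; a second neighbour [y] further along closes the cycle [x], [y1],
     ..., [y]. *)
  have /set0Pn[y] : [set u in S | e x u] :\ y1 != set0.
    by rewrite -card_gt0; move: deg2x; rewrite (cardsD1 y1); case: (_ \in _); lia.
  rewrite in_setD1 => /andP[yy1 yN].
  have := in_p y yN; rewrite inE (negbTE yy1) /= => yp.
  have exy : e x y by move: yN; rewrite inE => /andP[].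
  case/splitPr: yp up ep => p1 p2 up ep.
  apply/(negP (e_acyclic (x :: y1 :: rcons p1 y) _ _)).
  - by move: up; rewrite -cat_rcons -!cat_cons cat_uniq => /andP[].
  - by rewrite /= size_rcons.
  move: ep; rewrite -cat_rcons -cat_cons cat_path => /andP[ep _].
  by rewrite /cycle rcons_path ep /= last_rcons e_sym.
have [x [p [_ /card_uniqP cp _ sp]]] := long #|V|.
by have := max_card [in x :: p]; rewrite cp /= sp ltnn.
Qed.

(** Removing a vertex with at most one neighbour in [S] lowers the sum by at most 2: its own count,
    and the same amount at its neighbours. *)
Lemma forest_degree_sum (V : finType) (e : rel V) (S : {set V}) :
  simple_graph e -> forest e ->
  \sum_(v in S) #|[set u in S | e v u]| <= 2 * #|S|.
Proof.
move=> e_simple e_acyclic; have [n] := ubnP #|S|.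
elim: n S => // n IH S ltSn; case: (eqVneq S set0) => [->|S0].
  by rewrite big_set0.
have [v vS dv] := forest_low_degree e_simple e_acyclic S0.
have [e_sym e_irr] := e_simple.
have cS : #|S| = #|S :\ v|.+1 by rewrite (cardsD1 v) vS.
rewrite (big_setD1 v) //=.
have split_deg u : u \in S :\ v ->
    #|[set w in S | e u w]| = #|[set w in S :\ v | e u w]| + e v u.
  move=> _; rewrite (cardsD1 v) inE vS /= e_sym addnC; congr (_ + _).
  by apply: eq_card => w; rewrite !inE andbA.
rewrite (eq_bigr _ split_deg) big_split /=.
have -> : \sum_(u in S :\ v) nat_of_bool (e v u) = #|[set u in S | e v u]|.
  rewrite -sum1dep_card big_mkcondr /= [RHS](big_setD1 v) //=.
  rewrite e_irr add0n.
  by apply: eq_bigr => u _; case: (e v u).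
have := IH (S :\ v); rewrite cS in ltSn *; lia.
Qed.

(** * Leaves and the choice of the upper ones *)

Definition leaves (V : finType) (e : rel V) : {set V} := [set v | deg e v == 1].

Definition nbr (V : finType) (e : rel V) (v : V) : V := odflt v [pick u | e v u].

Lemma leaf_nbr (V : finType) (e : rel V) (l v : V) :
  l \in leaves e -> e l v = (v == nbr e l).
Proof.
rewrite inE => /cards1P[u /setP lu].
have e_l w : e l w = (w == u) by have := lu w; rewrite !inE.
rewrite /nbr; case: pickP => [w|/(_ u)]; rewrite !e_l ?eqxx //.
by move=> /eqP->.
Qed.

Lemma mem_leaf_nbr (V : finType) (e : rel V) (l : V) :
  l \in leaves e -> e l (nbr e l).
Proof. by move=> ll; rewrite leaf_nbr. Qed.

Lemma set_between (T : finType) (A B : {set T}) (n : nat) :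
  A \subset B -> #|A| <= n -> n <= #|B| ->
  exists C : {set T}, [/\ A \subset C, C \subset B & #|C| = n].
Proof.
move=> sAB; elim: n => [|n IH] An nB.
  by exists A; split => //; lia.
move: An; rewrite leq_eqVlt => /orP[/eqP An|An]; first by exists A.
have [C [sAC sCB cC]] := IH An (ltnW nB).
have /set0Pn[x] : B :\: C != set0.
  by rewrite -card_gt0 cardsD (setIidPr sCB) cC; lia.
rewrite inE => /andP[xC xB]; exists (x |: C); split.
- exact: subset_trans sAC (subsetUr _ _).
- by rewrite subUset sub1set xB.
- by rewrite cardsU1 xC cC.
Qed.

(** The leaves forced into [U] are those at a vertex of degree 2 ([W2]) and one representative for
    every other vertex with several leaves ([W3]). They are few enough, so [U] is any superset of
    the right size. *)
Lemma upper_leaves_exist (V : finType) (e : rel V) :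
  symmetric e -> n_deg e 2 <= 1 ->
  exists U : {set V},
    [/\ U \subset leaves e, #|U| <= (n_deg e 1 + 2) %/ 2,
        #|leaves e :\: U| < (n_deg e 1 + 2) %/ 2,
        (forall l, l \in leaves e :\: U -> deg e (nbr e l) != 2)
      & forall v, 1 < #|[set l in leaves e | e v l]| -> exists2 l, l \in U & e v l].
Proof.
move=> e_sym n2; pose L := leaves e; pose Lv v := [set l in L | e v l].
have cL : n_deg e 1 = #|L| by [].
pose rep v := odflt v [pick l in Lv v].
pose rep' v := odflt v [pick l in Lv v :\ rep v].
pose W2 := [set l in L | deg e (nbr e l) == 2].
pose W3 := [set l in L | [&& deg e (nbr e l) != 2, 1 < #|Lv (nbr e l)| & l == rep (nbr e l)]].
have W2le : #|W2| <= 2.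
  case: (eqVneq W2 set0) => [->|/set0Pn[l]]; first by rewrite cards0.
  rewrite inE => /andP[lL /eqP dz]; rewrite -dz; apply: subset_leq_card.
  apply/subsetP => l'; rewrite !inE => /andP[l'L dz'].
  have -> : nbr e l = nbr e l'.
    have /card_le1_eqP := n2; apply; rewrite inE ?dz //.
  by rewrite e_sym; apply: mem_leaf_nbr; rewrite inE.
have repP v : 1 < #|Lv v| -> rep v \in Lv v.
  rewrite /rep; case: pickP => [//|L0].
  by rewrite (eq_card0 L0).
have rep'P v : 1 < #|Lv v| -> (rep' v != rep v) && (rep' v \in Lv v).
  move=> Lv2; rewrite /rep'; case: pickP => [x|L0]; first by rewrite in_setD1.
  by have := Lv2; rewrite (cardsD1 (rep v)) repP // (eq_card0 L0).
have LvP v l : l \in Lv v -> (l \in L) && (nbr e l == v).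
  by rewrite inE => /andP[lL]; rewrite lL e_sym (leaf_nbr _ lL) eq_sym.
pose W := W2 :|: W3.
have WL : W \subset L.
  by apply/subsetP => l; rewrite !inE => /orP[] /andP[].
(* A second leaf [rep'] at the same vertex maps [W3] injectively into the leaves outside [W]. *)
have W3le : #|W3| + #|W| <= #|L|.
  rewrite -(cardsID W L) (setIidPr WL) addnC leq_add2l.
  rewrite -(card_in_imset (f := fun l => rep' (nbr e l)) (D := W3)).
    apply: subset_leq_card; apply/subsetP => _ /imsetP[l lW ->].
    move: lW; rewrite inE => /and4P[lL d2 Lv2 lr].
    have /andP[rr /LvP/andP[rL /eqP nr]] := rep'P _ Lv2.
    by rewrite inE rL andbT inE !inE nr (negbTE d2) (negbTE rr) !andbF.
  move=> l l'; rewrite !inE => /and4P[_ _ Ll /eqP lr] /and4P[_ _ Ll' /eqP lr'] eqr.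
  have /andP[_ /LvP/andP[_ /eqP nr]] := rep'P _ Ll.
  have /andP[_ /LvP/andP[_ /eqP nr']] := rep'P _ Ll'.
  by rewrite lr lr' -nr -nr' eqr.
(* Adding [#|W| <= 2 + #|W3|] to [W3le] gives [2 * #|W| <= #|L| + 2]. *)
have Wle : #|W| <= minn #|L| ((#|L| + 2) %/ 2).
  have := subset_leq_card WL; have [] := leq_card_setU W2 W3; rewrite -/W; lia.
have [U [WU UL cU]] := set_between WL Wle (geq_minl _ _).
exists U; rewrite cL; split => //.
- by rewrite cU geq_minr.
- by rewrite cardsD (setIidPr UL) cU -/L; lia.
- move=> l; rewrite inE => /andP[lU lL]; apply: contra lU => d2.
  by apply/(subsetP WU)/setUP; left; rewrite inE lL.
- move=> v Lv2; have rv := repP v Lv2; have /andP[rL /eqP nr] := LvP _ _ rv.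
  exists (rep v); last by move: rv; rewrite inE => /andP[].
  apply/(subsetP WU)/setUP; have [d2|d2] := boolP (deg e v == 2).
    by left; rewrite inE rL nr.
  by right; rewrite inE rL nr d2 Lv2 eqxx.
Qed.

(** * Numbering of the leaves *)

(** Low leaves adjacent to an upper leaf ([M]) are numbered first. Their upper partners copy these
    numbers, and the remaining upper leaves continue after [#|M|], so neither side exceeds its
    cardinality. *)
Lemma exists_leaf_numbering (V : finType) (e : rel V) (U D : {set V}) :
  symmetric e -> U \subset leaves e -> D \subset leaves e -> [disjoint U & D] ->
  exists num : V -> nat,
    [/\ {in D &, injective num}, {in U &, injective num},
        (forall l, l \in D -> 0 < num l <= #|D|),
        (forall l, l \in U -> 0 < num l <= #|U|)
      & forall l, l \in U -> nbr e l \in D -> num l = num (nbr e l)].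
Proof.
move=> e_sym /subsetP UL /subsetP DL UD.
pose UM := [set u in U | nbr e u \in D]; pose M := [set nbr e u | u in UM].
have nbrK u : u \in leaves e -> nbr e u \in leaves e -> nbr e (nbr e u) = u.
  by move=> uL nL; have := mem_leaf_nbr uL; rewrite e_sym leaf_nbr // => /eqP/esym.
have UMP u : u \in UM -> [/\ u \in U, nbr e u \in D & nbr e (nbr e u) = u].
  by rewrite inE => /andP[uU uD]; split=> //; apply: nbrK; [apply: UL|apply: DL].
have cM : #|M| = #|UM|.
  by apply: card_in_imset => u u' /UMP[_ _ {2}<-] /UMP[_ _ {2}<-] ->.
have MD : M \subset D by apply/subsetP => _ /imsetP[u /UMP[_ ? _] ->].
have UMU : UM \subset U by apply/subsetP => u /UMP[].
pose sD := enum M ++ enum (D :\: M); pose sU := enum (U :\: UM).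
pose num x := (if x \in D then index x sD else
  if nbr e x \in D then index (nbr e x) sD else #|M| + index x sU).+1.
have sDE x : (x \in sD) = (x \in D).
  rewrite mem_cat !mem_enum inE; case: (boolP (x \in M)) => //= xM.
  by rewrite (subsetP MD).
have size_sD : size sD = #|D|.
  by rewrite size_cat -!cardE -(cardsID M D) (setIidPr MD).
have U_D x : x \in U -> (x \in D) = false by move=> /(disjointFr UD).
have numU x : x \in U -> num x = (if nbr e x \in D then index (nbr e x) sD else #|M| + index x sU).+1.
  by move=> /U_D xD; rewrite /num xD.
have ltM x : x \in U -> nbr e x \in D -> index (nbr e x) sD < #|M|.
  move=> xU nD; have nM : nbr e x \in M by apply: imset_f; rewrite inE xU.
  by rewrite index_cat mem_enum nM cardE index_mem mem_enum.
have memsU x : x \in U -> nbr e x \notin D -> x \in sU.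
  by move=> xU nD; rewrite mem_enum !inE xU (negbTE nD).
have index_inj s x y : x \in s -> y \in s -> index x s = index y s -> x = y :> V.
  by move=> xs ys eqi; rewrite -(nth_index x xs) eqi nth_index.
exists num; split.
- by move=> x y xD yD; rewrite /num xD yD => -[/index_inj->]; rewrite ?sDE.
- move=> x y xU yU; rewrite !numU // => -[].
  case: ifP (ltM x xU) => [nx /(_ isT) lx|/negbT nx _];
  case: ifP (ltM y yU) => [ny /(_ isT) ly|/negbT ny _]; try lia.
    move=> /index_inj eqn; have {eqn} := eqn _ _; rewrite !sDE nx ny => /(_ isT isT) eqn.
    by have := nbrK x (UL _ xU) (DL _ nx); rewrite eqn (nbrK y (UL _ yU) (DL _ ny)).
  by move=> /addnI/index_inj->; rewrite ?memsU.
- by move=> x xD; rewrite /num xD -size_sD index_mem sDE.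
- move=> x xU; rewrite numU //= -(cardsID UM U) (setIidPr UMU) -cM.
  case: ifP (ltM x xU) => [_ /(_ isT)|/negbT nx _]; first lia.
  by rewrite ltn_add2l cardE index_mem memsU.
- by move=> x xU nD; rewrite numU // nD /num nD.
Qed.

(** * The edge weights and the intended weighted degrees *)

Section Weighting.

Variables (V : finType) (e : rel V) (U : {set V}) (s : nat) (num : V -> nat).
Let D := leaves e :\: U.
Hypothesis e_simple : simple_graph e.
Hypothesis e_acyclic : forest e.
Hypothesis deg_neq0 : forall v, deg e v != 0.
Hypothesis n_deg2 : n_deg e 2 <= 1.
Hypothesis U_leaves : U \subset leaves e.
Hypothesis card_U : #|U| <= s.
Hypothesis card_D : #|D| < s.
Hypothesis D_deg2 : forall l, l \in D -> deg e (nbr e l) != 2.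
Hypothesis U_nbr : forall v, 1 < #|[set l in leaves e | e v l]| ->
  exists2 u, u \in U & e v u.
Hypothesis num_D_inj : {in D &, injective num}.
Hypothesis num_U_inj : {in U &, injective num}.
Hypothesis num_D : forall l, l \in D -> 0 < num l <= #|D|.
Hypothesis num_U : forall l, l \in U -> 0 < num l <= #|U|.
Hypothesis num_nbr : forall l, l \in U -> nbr e l \in D -> num l = num (nbr e l).

Definition low (v : V) : {set V} := [set l in D | e v l].

Definition upper_deg (v : V) : nat := #|[set u | e v u & u \notin D]|.

(** Numbers of low leaves are positive, so the value is 0 exactly when [low v] is empty. *)
Definition max_low (v : V) : nat := \max_(l in low v) num l.

Definition low_edge (l : V) : nat :=
  if [&& nbr e l \notin D, upper_deg (nbr e l) <= 1 & num l == max_low (nbr e l)]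
  then num l else 1.

(** When both ends are low, the choice made by [pick] is harmless: [low_edge] is 1 at either end. *)
Definition edge_weight (f : {set V}) : nat :=
  if [pick l in D :&: f] is Some l then low_edge l else s.

Definition edge_sum (v : V) : nat := \sum_(u in V | e v u) edge_weight [set v; u].

Definition high : {set V} := [set v | (v \notin leaves e) && (2 < upper_deg v)].

(* On [high] the last summand makes the value congruent to the index of [v] modulo [s]. *)
Definition target (v : V) : nat :=
  if v \in D then (num v).+1
  else if v \in U then s + num v
  else if upper_deg v <= 2 then (2 * s + max_low v).+1
  else (edge_sum v).+1 + (index v (enum high) + s.-1 * (edge_sum v).+1) %% s.

Let e_sym : symmetric e := proj1 e_simple.

(** * Weights and sums of the edges at a vertex *)

Lemma D_leaf l : l \in D -> l \in leaves e.
Proof. by rewrite inE => /andP[]. Qed.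

Lemma leafE v : (v \in leaves e) = (v \in D) || (v \in U).
Proof.
rewrite /D in_setD; case: (boolP (v \in U)) => [/(subsetP U_leaves)->|] //=.
by rewrite orbF.
Qed.

Lemma lowP v l : l \in low v -> l \in D /\ nbr e l = v.
Proof.
rewrite inE => /andP[lD]; rewrite e_sym (leaf_nbr _ (D_leaf lD)) => /eqP->.
by split.
Qed.

Lemma deg_split v : deg e v = #|low v| + upper_deg v.
Proof.
rewrite /deg -(cardsID D); by congr (_ + _); apply: eq_card => u; rewrite !inE andbC.
Qed.

(** The numbers of the low leaves at [v] are distinct and lie between 1 and [max_low v]. *)
Lemma card_low v : #|low v| <= max_low v.
Proof.
pose f (l : V) : 'I_(max_low v).+1 := inord (num l).
have num_le l : l \in low v -> 0 < num l <= max_low v.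
  move=> ll; have [lD _] := lowP ll; have /andP[-> _] := num_D lD.
  exact: leq_bigmax_cond.
rewrite -(card_in_imset (f := f) (D := low v)) => [|l l' ll ll' /(congr1 val)].
  have : f @: low v \subset [set~ ord0].
    apply/subsetP => _ /imsetP[l ll ->]; rewrite !inE -val_eqE /= inordK.
      by have /andP[] := num_le l ll; case: (num l).
    by rewrite ltnS; have /andP[] := num_le l ll.
  by move=> /subset_leq_card; rewrite cardsC1 card_ord.
have /andP[_ h] := num_le l ll; have /andP[_ h'] := num_le l' ll'.
rewrite /= !inordK ?ltnS //; apply: num_D_inj.
  by have [] := lowP ll.
by have [] := lowP ll'.
Qed.

Lemma max_low_le v : max_low v <= #|D|.
Proof.
by apply/bigmax_leqP => l /lowP[/num_D/andP[]].
Qed.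

Lemma max_low_attained v : low v != set0 -> exists2 l, l \in low v & num l = max_low v.
Proof.
move=> v0; have : 0 < #|low v| by rewrite card_gt0.
by move=> /(eq_bigmax_cond num)[l ll eqn]; exists l.
Qed.

Lemma low_edge_bounds l : l \in D -> 0 < low_edge l <= num l.
Proof.
by move=> /num_D/andP[l0 _]; rewrite /low_edge; case: ifP; rewrite l0 /=.
Qed.

Lemma edge_weight_low l v : l \in D -> e v l -> edge_weight [set v; l] = low_edge l.
Proof.
move=> lD vl; rewrite /edge_weight; case: pickP => [x|/(_ l)]; last first.
  by rewrite in_setI in_set2 lD eqxx orbT.
rewrite in_setI in_set2 => /andP[xD /orP[]/eqP xE]; rewrite xE // in xD *.
(* Here [pick] returned the other end [v], so the edge is isolated with two low ends. *)
have nv : nbr e v = l by apply/esym/eqP; rewrite -leaf_nbr ?D_leaf.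
have nl : nbr e l = v by apply/esym/eqP; rewrite -leaf_nbr ?D_leaf // e_sym.
by rewrite /low_edge nv nl lD xD.
Qed.

Lemma edge_weight_upper u v : u \notin D -> v \notin D -> edge_weight [set u; v] = s.
Proof.
move=> uD vD; rewrite /edge_weight; case: pickP => // x.
by rewrite in_setI in_set2 => /andP[xD /orP[]/eqP xE]; move: xD; rewrite xE ?(negbTE uD) ?(negbTE vD).
Qed.

Lemma edge_weight_bounds u v : e u v -> 0 < edge_weight [set u; v] <= s.
Proof.
have low_le l : l \in D -> 0 < low_edge l <= s.
  by move=> lD; have := low_edge_bounds lD; have := num_D lD; lia.
move=> uv; have [vD|vD] := boolP (v \in D).
  by rewrite edge_weight_low ?low_le.
have [uD|uD] := boolP (u \in D).
  by rewrite setUC edge_weight_low ?low_le // e_sym.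
by rewrite edge_weight_upper // leqnn andbT; lia.
Qed.

Lemma edge_sum_D l : l \in D -> edge_sum l = low_edge l.
Proof.
move=> lD; rewrite /edge_sum (big_pred1 (nbr e l)) => [|u].
  by rewrite setUC edge_weight_low // e_sym mem_leaf_nbr ?D_leaf.
by rewrite /= leaf_nbr ?D_leaf.
Qed.

Lemma edge_sum_split v : v \notin D ->
  edge_sum v = \sum_(l in low v) low_edge l + s * upper_deg v.
Proof.
move=> vD; rewrite /edge_sum (bigID [in D]) /=; congr (_ + _).
  rewrite (eq_bigl [in low v]) => [|l]; last by rewrite /= [RHS]in_set andbC.
  by apply: eq_bigr => l; rewrite inE => /andP[lD vl]; rewrite edge_weight_low.
rewrite (eq_bigr (fun=> s)) => [|u /andP[_ uD]]; last exact: edge_weight_upper.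
by rewrite sum_nat_const mulnC; congr (_ * _); apply: eq_card => u; rewrite [RHS]in_set.
Qed.

Lemma edge_sum_upper2 v : v \notin D -> 1 < upper_deg v ->
  edge_sum v = #|low v| + s * upper_deg v.
Proof.
move=> vD v2; rewrite edge_sum_split // -sum1_card; congr (_ + _).
apply: eq_bigr => l /lowP[_ nl]; by rewrite /low_edge nl leqNgt v2 andbF.
Qed.

(** The low leaf of largest number contributes [max_low v] and every other one contributes 1; the
    successor on the left avoids a subtraction. *)
Lemma edge_sum_upper1 v : v \notin D -> upper_deg v <= 1 -> low v != set0 ->
  (edge_sum v).+1 = max_low v + #|low v| + s * upper_deg v.
Proof.
move=> vD v1 v0; rewrite edge_sum_split //.
have [l ll lmax] := max_low_attained v0.
have low_edgeE l' : l' \in low v -> low_edge l' = if l' == l then num l else 1.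
  move=> ll'; have [lD' nl'] := lowP ll'; rewrite /low_edge nl' vD v1 -lmax /=.
  have [lD _] := lowP ll.
  have -> : (num l' == num l) = (l' == l).
    by apply/eqP/eqP => [|->//]; apply: num_D_inj.
  by case: eqP => // ->.
rewrite (big_setD1 l) //= low_edgeE // eqxx (eq_bigr (fun=> 1)) => [|l']; last first.
  by rewrite !inE => /andP[/negbTE ll' H]; rewrite low_edgeE ?inE ?ll'.
by rewrite sum1_card lmax (cardsD1 l (low v)) ll; lia.
Qed.

(** * Non-low degrees of internal vertices *)

Lemma internal_deg v : v \notin leaves e -> 1 < deg e v.
Proof. by rewrite inE; have := deg_neq0 v; lia. Qed.

Lemma low_deg2 v : deg e v = 2 -> low v = set0.
Proof.
move=> dv; apply/setP => l; rewrite in_set0; apply/negP => /lowP[lD nl].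
by have := D_deg2 lD; rewrite nl dv.
Qed.

Lemma upper_nbr v : 1 < #|low v| -> exists2 u, u \in U & e v u.
Proof.
move=> v2; apply: U_nbr; apply: leq_trans v2 _; apply: subset_leq_card.
by apply/subsetP => l; rewrite !inE => /andP[/andP[_ ->] ->].
Qed.

Lemma U_notin_D u : u \in U -> u \notin D.
Proof. by rewrite inE => ->. Qed.

(** Two low leaves force an upper one; with at most one low leaf, degree at least 2 leaves a non-low
    neighbour. *)
Lemma upper_deg_gt0 v : v \notin leaves e -> 0 < upper_deg v.
Proof.
move=> vL; have := internal_deg vL; rewrite deg_split.
have [/upper_nbr[u uU vu]|] := ltnP 1 #|low v|; last by lia.
by move=> _; rewrite card_gt0; apply/set0Pn; exists u; rewrite inE vu U_notin_D.
Qed.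

(** Two low leaves at [w] force an upper leaf besides [v]. With at most one, either the degree is at
    least 3, or it is 2 and no leaf at [w] is low. *)
Lemma upper_deg_internal_nbr v w :
  v \notin leaves e -> w \notin leaves e -> e w v -> 1 < upper_deg w.
Proof.
move=> vL wL wv; have [/upper_nbr[u uU wu]|w1] := ltnP 1 #|low w|.
  have uv : u != v by apply: contraNneq vL => <-; apply: (subsetP U_leaves).
  have <- : #|[set u; v]| = 2 by rewrite cards2 uv.
  apply: subset_leq_card; apply/subsetP => x; rewrite !in_set2 inE.
  case/orP=> /eqP->; first by rewrite wu U_notin_D.
  by rewrite wv; apply: contra vL => /D_leaf.
have := internal_deg wL; have := deg_split w; have := @low_deg2 w.
case: (eqVneq (deg e w) 2) => [-> /(_ erefl)->|]; last by lia.
by rewrite cards0 add0n => <-.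
Qed.

(* Each vertex of [P] sends its non-low edges to [P] or to [U]; the former are few because
   the graph induced on [P] is a forest. *)
Lemma card_high : #|high| <= s.
Proof.
apply: leq_trans card_U.
pose P := [set v | (v \notin leaves e) && (1 < upper_deg v)].
have P_deg v : v \in P ->
    upper_deg v <= #|[set u in P | e v u]| + \sum_(u in U) e v u.
  rewrite in_set => /andP[vL _].
  have -> : \sum_(u in U) e v u = #|[set u in U | e v u]|.
    by rewrite -sum1dep_card big_mkcondr; apply: eq_bigr => u _; case: (e v u).
  apply: leq_trans (leq_card_setU _ _).1; apply: subset_leq_card.
  apply/subsetP => u; rewrite in_set => /andP[vu uD]; apply/setUP.
  have [uU|uU] := boolP (u \in U); [right|left]; rewrite in_set vu ?uU // andbT.
  have uL : u \notin leaves e by rewrite leafE negb_or uD.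
  by rewrite in_set uL; apply: (@upper_deg_internal_nbr v) => //; rewrite e_sym.
have U_sum : \sum_(v in P) \sum_(u in U) e v u <= #|U|.
  rewrite exchange_big -sum1_card /=; apply: leq_sum => u /(subsetP U_leaves).
  rewrite inE => /eqP <-; rewrite /deg -sum1dep_card [X in _ <= X]big_mkcond.
  rewrite [X in X <= _]big_mkcond; apply: leq_sum => v _.
  by rewrite e_sym; case: (v \in P); case: (e u v).
(* A vertex of [P] has at least two non-low edges, and a third if it is in [high]. *)
have high_sum : #|high| + 2 * #|P| <= \sum_(v in P) upper_deg v.
  have -> : #|high| = \sum_(v in P) (v \in high).
    rewrite -sum1_card big_mkcond [RHS]big_mkcond; apply: eq_bigr => v _.
    by rewrite !inE; case: (deg e v == 1) => //=; case: (upper_deg v) => [|[|[]]].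
  rewrite -sum1_card big_distrr -big_split /=; apply: leq_sum => v.
  by rewrite !inE; case: (deg e v == 1) => //=; case: (upper_deg v) => [|[|[]]].
have := forest_degree_sum P e_simple e_acyclic.
have := leq_sum (index_enum V) P_deg.
by rewrite big_split /=; lia.
Qed.

(** * Feasibility and injectivity of the target values *)

(** This places the vertex weight [target v - edge_sum v] between 1 and [s]. *)
Lemma target_bounds v : edge_sum v < target v <= edge_sum v + s.
Proof.
have s0 : 0 < s by lia.
rewrite /target; case: ifPn => vD.
  have := low_edge_bounds vD; have := num_D vD; rewrite edge_sum_D //; lia.
have mD := max_low_le v; have clow := card_low v.
have lowD : #|low v| <= #|D| by lia.
case: ifPn => vU.
  have := num_U vU; have vL := subsetP U_leaves v vU.
  have [v0|v0] := eqVneq (low v) set0.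
    move: (vL); rewrite inE => /eqP; rewrite deg_split v0 cards0 add0n => dv.
    by rewrite edge_sum_split // v0 big_set0 dv; lia.
  have [l ll lmax] := max_low_attained v0; have [lD nl] := lowP ll.
  have vn : nbr e v = l.
    apply/esym/eqP; rewrite -leaf_nbr //.
    by move: ll; rewrite inE => /andP[].
  (* On an isolated edge between [U] and [D] the edge weight is the common number, so the vertex
     weight at [v] is exactly [s]. *)
  have := num_nbr vU; rewrite vn lmax => /(_ lD) ->.
  move: (vL); rewrite inE => /eqP; rewrite deg_split.
  move: (v0); rewrite -card_gt0 => v0' dv.
  have k0 : upper_deg v = 0 by lia.
  by have := edge_sum_upper1 vD _ v0; rewrite k0 => /(_ isT); lia.
have vL : v \notin leaves e by rewrite leafE negb_or vD.
case: ifPn => [k2|k2]; last first.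
  by have := ltn_pmod (index v (enum high) + s.-1 * (edge_sum v).+1) s0; lia.
have := upper_deg_gt0 vL; have := internal_deg vL; have := deg_split v => dv.
have [k1|k1] := leqP (upper_deg v) 1; last first.
  have {}k2 : upper_deg v = 2 by lia.
  (* The difference is [max_low v - #|low v| + 1], which is positive by [card_low]. *)
  by rewrite edge_sum_upper2 // k2; lia.
move=> d1 k0; have {k0} {}k1 : upper_deg v = 1 by lia.
(* The difference will be [s + 2 - #|low v|], so two low leaves are needed, that is, degree at least
   3. *)
have d2 : deg e v != 2.
  by apply/eqP => d2; move: dv; rewrite d2 (low_deg2 d2) cards0 k1.
have v0 : low v != set0 by rewrite -card_gt0; lia.
by have := edge_sum_upper1 vD _ v0; rewrite k1 => /(_ isT); lia.
Qed.

(** The four cases of [target] take values in disjoint ranges cut at [s], [2 * s] and [3 * s], so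
    only two vertices of the same kind have to be compared. *)
Lemma target_inj : injective target.
Proof.
have s0 : 0 < s by lia.
have D_range v : v \in D -> target v <= s.
  by move=> vD; rewrite /target vD; have := num_D vD; lia.
have U_range v : v \notin D -> v \in U -> s < target v <= 2 * s.
  by move=> vD vU; rewrite /target (negbTE vD) vU; have := num_U vU; lia.
have k2_range v : v \notin D -> v \notin U -> upper_deg v <= 2 ->
    2 * s < target v <= 3 * s.
  move=> vD vU k2; rewrite /target (negbTE vD) (negbTE vU) k2.
  by have := max_low_le v; lia.
have high_range v : v \notin D -> v \notin U -> 2 < upper_deg v -> 3 * s < target v.
  move=> vD vU k2; have := target_bounds v; rewrite edge_sum_upper2 //; last by lia.
  have : 3 * s <= s * upper_deg v by rewrite mulnC leq_mul2l k2 orbT.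
  lia.
move=> u v Tuv.
have [uD|uD] := boolP (u \in D); have [vD|vD] := boolP (v \in D).
- by move: Tuv; rewrite /target uD vD => -[]; apply: num_D_inj.
- have := D_range u uD; have [vU|vU] := boolP (v \in U); first by have := U_range v vD vU; lia.
  by have [k|k] := leqP (upper_deg v) 2; [have := k2_range v vD vU k|have := high_range v vD vU k]; lia.
- have := D_range v vD; have [uU|uU] := boolP (u \in U); first by have := U_range u uD uU; lia.
  by have [k|k] := leqP (upper_deg u) 2; [have := k2_range u uD uU k|have := high_range u uD uU k]; lia.
have [uU|uU] := boolP (u \in U); have [vU|vU] := boolP (v \in U).
- move: Tuv; rewrite /target (negbTE uD) (negbTE vD) uU vU => /addnI.
  exact: num_U_inj.
- have := U_range u uD uU.
  by have [k|k] := leqP (upper_deg v) 2; [have := k2_range v vD vU k|have := high_range v vD vU k]; lia.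
- have := U_range v vD vU.
  by have [k|k] := leqP (upper_deg u) 2; [have := k2_range u uD uU k|have := high_range u uD uU k]; lia.
have uL : u \notin leaves e by rewrite leafE negb_or uD.
have vL : v \notin leaves e by rewrite leafE negb_or vD.
have [ku|ku] := leqP (upper_deg u) 2; have [kv|kv] := leqP (upper_deg v) 2.
- move: Tuv; rewrite /target (negbTE uD) (negbTE vD) (negbTE uU) (negbTE vU) ku kv.
  move=> -[/addnI eqm].
  (* A common value of [max_low] is either 0, which singles out the one vertex of degree 2, or the
     number of a low leaf, which determines its neighbour. *)
  have deg2 w : w \notin leaves e -> upper_deg w <= 2 -> max_low w = 0 -> deg e w = 2.
    move=> wL kw mw; have := internal_deg wL; have := card_low w; rewrite deg_split mw; lia.
  case: (posnP (max_low u)) => [mu|mu].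
    have /card_le1_eqP := n_deg2; apply; rewrite inE; apply/eqP; apply: deg2 => //.
    by rewrite -eqm.
  have low_neq0 w : 0 < max_low w -> low w != set0.
    by apply: contraTneq; rewrite /max_low => ->; rewrite big_set0.
  have [l lu lmax] := max_low_attained (low_neq0 _ mu).
  rewrite eqm in mu; have [l' lv lmax'] := max_low_attained (low_neq0 _ mu).
  have [lD <-] := lowP lu; have [lD' <-] := lowP lv; congr (nbr e _).
  by apply: num_D_inj => //; rewrite lmax lmax'.
- by have := k2_range u uD uU ku; have := high_range v vD vU kv; lia.
- by have := k2_range v vD vU kv; have := high_range u uD uU ku; lia.
have target_mod w : w \notin leaves e -> 2 < upper_deg w -> target w %% s = index w (enum high).
  move=> wL kw; move: (wL); rewrite leafE negb_or => /andP[/negbTE wD /negbTE wU].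
  (* The multiples of [(edge_sum w).+1] add up to [s] times it; the index is below [s] by
     [card_high]. *)
  rewrite /target wD wU leqNgt kw /= modnDmr addnCA -mulSn prednK //.
  rewrite addnC mulnC modnMDl modn_small //; apply: leq_trans card_high.
  by rewrite cardE index_mem mem_enum inE wL.
have := congr1 (modn^~ s) Tuv; rewrite /= !target_mod // => eqi.
have highP w : w \notin leaves e -> 2 < upper_deg w -> w \in enum high.
  by move=> wL kw; rewrite mem_enum inE wL.
by rewrite -(nth_index u (highP u uL ku)) eqi nth_index ?highP.
Qed.

Lemma weighting_irregular : has_irregular_weighting e s.
Proof.
exists (fun v => target v - edge_sum v), edge_weight; split; last split.
- by move=> v; have := target_bounds v; lia.
- exact: edge_weight_bounds.
- move=> u v; rewrite /wdeg -!/(edge_sum _).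
  have := target_bounds u; have := target_bounds v => Tv Tu Tuv.
  by apply: target_inj; lia.
Qed.

End Weighting.

(** * The lower bound and the formula *)

Lemma irregular_weighting_leaves (V : finType) (e : rel V) (t : nat) :
  0 < t -> has_irregular_weighting e t -> (n_deg e 1 + 2) %/ 2 <= t.
Proof.
move=> t0 [wv [we [wvP [weP wdeg_inj]]]].
have leaf_wdeg l : l \in leaves e -> 2 <= wdeg e wv we l <= 2 * t.
  move=> lL; rewrite /wdeg (big_pred1 (nbr e l)) => [|u]; last by rewrite /= leaf_nbr.
  by have := wvP l; have := weP _ _ (mem_leaf_nbr lL); lia.
have wdeg_uniq : uniq (map (wdeg e wv we) (enum (leaves e))).
  by rewrite map_inj_uniq ?enum_uniq.
(* The list runs from 2 to [2 * t], so there are at most [2 * t - 1] leaves. *)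
have /(uniq_leq_size wdeg_uniq) :
    {subset map (wdeg e wv we) (enum (leaves e)) <= iota 2 (2 * t - 1)}.
  by move=> _ /mapP[l + ->]; rewrite mem_enum mem_iota => /leaf_wdeg; lia.
rewrite size_map size_iota -cardE -/(n_deg e 1); lia.
Qed.

(* tvs(F) = ceil((n1+1)/2) = (n1 + 2) %/ 2 *)
Theorem theorem2 (V : finType) (e : rel V) :
  simple_graph e -> forest e ->
  (forall v : V, deg e v != 0) ->
  n_deg e 2 <= 1 ->
  is_tvs e ((n_deg e 1 + 2) %/ 2).
Proof.
move=> e_simple e_acyclic deg_neq0 n2; have [e_sym _] := e_simple.
split; first lia.
split; last by move=> t; apply: irregular_weighting_leaves.
have [U [UL cU cD D2 Unbr]] := upper_leaves_exist e_sym n2.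
have UD : [disjoint U & leaves e :\: U].
  by apply/pred0P => v; rewrite /= inE; case: (v \in U).
have [num [nDi nUi nD nU nn]] :=
  exists_leaf_numbering e_sym UL (subsetDl (leaves e) U) UD.
exact: (weighting_irregular e_simple e_acyclic deg_neq0 n2 UL cU cD D2 Unbr nDi nUi nD nU nn).
Qed.
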